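(* Let $(D,G)$ be a group pair with Manin pair $(\mathfrak d,\mathfrak g)$, and let the connected quasi-Poisson Lie group $G_D^{\mathfrak h}$ act by a quasi-Poisson action on a manifold with bivector $(M,P_M^{\mathfrak h})$. Then $$\{f_1,f_2\}=P_M^{\mathfrak h}(df_1,df_2)$$ defines a Poisson bracket on the space $C^\infty(M)^G$ of smooth $G$-invariant functions on $M$ (in particular the bracket of two $G$-invariant functions is $G$-invariant and the Jacobi identity holds). This Poisson bracket is independent of the choice of the isotropic complement $\mathfrak h$: if $\mathfrak h$ is replaced by another isotropic complement $\mathfrak h'$ of $\mathfrak g$ in $\mathfrak d$ and $P_M^{\mathfrak h}$ by $P_M^{\mathfrak h'}=P_M^{\mathfrak h}-t_M$, where $t$ is the twist from $\mathfrak h$ to $\mathfrak h'$, the bracket on $C^\infty(M)^G$ is the same.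
   Context: Everything is real, finite-dimensional and smooth; ''bivector'' on a manifold means bivector field. $a\wedge b=a\otimes b-b\otimes a$. Manin pair $(\mathfrak d,\mathfrak g)$: a Lie algebra $\mathfrak d$ of dimension $2n$ with an invariant nondegenerate symmetric bilinear form $(\cdot|\cdot)$ of signature $(n,n)$, and a Lie subalgebra $\mathfrak g\subset\mathfrak d$ that is a maximal isotropic subspace. A Manin quasi-triple $(\mathfrak d,\mathfrak g,\mathfrak h)$ is a Manin pair with an isotropic linear complement $\mathfrak h$, $\mathfrak d=\mathfrak g\oplus\mathfrak h$ ($\mathfrak h$ need not be a subalgebra). $p_{\mathfrak g},p_{\mathfrak h}$ are the projections; $j:\mathfrak g^*\to\mathfrak h$ is the isomorphism with $(j(\xi)|x)=\langle\xi,x\rangle$ for $\xi\in\mathfrak g^*,x\in\mathfrak g$. Define $F=F_{\mathfrak h}:\mathfrak g\to\bigwedge^2\mathfrak g$ by $F(x)(\xi,\eta)=\langle j^{-1}p_{\mathfrak h}[j\xi,j\eta],x\rangle$ and $\varphi=\varphi_{\mathfrak h}\in\bigwedge^3\mathfrak g$ by $\varphi(\xi,\eta,\zeta)=\langle\zeta,p_{\mathfrak g}[j\xi,j\eta]\rangle$. If $\mathfrak h'$ is another isotropic complement with isomorphism $j'$, the twist from $\mathfrak h$ to $\mathfrak h'$ is $t=j'-j$; it takes values in $\mathfrak g$, is anti-symmetric, and is regarded as $t\in\bigwedge^2\mathfrak g$ via $t(\xi,\eta)=\langle t(\xi),\eta\rangle$. A group pair $(D,G)$: a connected Lie group $D$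 with a bi-invariant scalar product and a connected closed Lie subgroup $G$ whose Lie algebras $(\mathfrak d,\mathfrak g)$ form a Manin pair. For a basis $(e_i)$ of $\mathfrak g$ with dual basis $(\varepsilon^i)$ of $\mathfrak g^*$ let $r_{\mathfrak d}=\sum_i e_i\otimes j(\varepsilon^i)$. $G_D^{\mathfrak h}$ denotes $G$ with the bivector $P_G^{\mathfrak h}$ obtained by restricting $r_{\mathfrak d}^\lambda-r_{\mathfrak d}^\rho$ (left- minus right-invariant tensor fields) to $G$, and the element $\varphi_{\mathfrak h}$; it is called a quasi-Poisson Lie group. If $G$ acts on $M$, for $x\in\mathfrak g$ let $x_M$ be the vector field $(x_M f)(m)=\frac{d}{dt}f(\exp(-tx)m)|_{t=0}$, extended multiplicatively to a map $\bigwedge\mathfrak g\to$ multivector fields on $M$. The action of $G_D^{\mathfrak h}$ on $(M,P_M^{\mathfrak h})$ is quasi-Poisson if $\frac12[P_M^{\mathfrak h},P_M^{\mathfrak h}]=(\varphi_{\mathfrak h})_M$ and $\mathcal L_{x_M}P_M^{\mathfrak h}=-F_{\mathfrak h}(x)_M$ for all $x\in\mathfrak g$. The Schouten bracket is normalized by $\frac12[P,P](df,dg,dh)=\{f,\{g,h\}\}+\text{cyclic}$, where $\{f,g\}=P(df,dg)$. When the complement is changed from $\mathfrak h$ to $\mathfrak h'$ by a twist $t$, the bivector on $M$ is changed to $P_M^{\mathfrak h'}=P_M^{\mathfrak h}-t_M$. *)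

(* Defs.v *)
(* MathComp / MathComp-Analysis, over an arbitrary [R : realType]. *)
From HB Require Import structures.
From mathcomp Require Import all_boot all_order all_algebra.
From mathcomp Require Import all_classical all_reals all_analysis.
Set Implicit Arguments.
Unset Strict Implicit.
Unset Printing Implicit Defensive.
Import Order.TTheory GRing.Theory Num.Theory.
Import numFieldNormedType.Exports.
Local Open Scope classical_set_scope.
Local Open Scope ring_scope.

Section Smoothness.
Context {R : realType}.

(* On an open set [S] this is the usual class C^k: [f] is C^(k+1) iff it is
   differentiable and all its directional derivatives are C^k.  It is only
   used for open [S], where 'D_v f on [S] depends only on the values on [S]. *)
Fixpoint Ck_on {V W : normedModType R} (k : nat) (S : set V) (f : V -> W)
    : Prop :=
  match k with
  | 0 => forall x, S x -> {for x, continuous f}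
  | k'.+1 => (forall x, S x -> differentiable f x) /\
             (forall v, Ck_on k' S ('D_v f))
  end.

Definition smooth_on {V W : normedModType R} (S : set V) (f : V -> W) : Prop :=
  forall k, Ck_on k S f.

(* [cfwd] matters only on [cdom], and [cinv] only on its image [cimg]. *)
Record chart (T : topologicalType) (n : nat) := Chart {
  cdom : set T;
  cfwd : T -> 'rV[R]_n;
  cinv : 'rV[R]_n -> T }.

Definition cimg T n (c : chart T n) : set 'rV[R]_n := cfwd c @` cdom c.

Definition chart_homeo T n (c : chart T n) : Prop :=
  [/\ open (cdom c), open (cimg c),
      forall x, cdom c x -> cinv c (cfwd c x) = x,
      forall x, cdom c x -> {for x, continuous (cfwd c)} &
      forall y, cimg c y -> {for y, continuous (cinv c)}].

Definition chart_compatible T n (c c' : chart T n) : Prop :=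
  smooth_on (cfwd c @` (cdom c `&` cdom c')) (cfwd c' \o cinv c).

End Smoothness.

Record manifold (R : realType) := Manifold {
  mspace :> topologicalType;
  mdim : nat;
  atlas : set (@chart R mspace mdim);
  manifold_hausdorff : hausdorff_space mspace;
  manifold_second_countable : @second_countable mspace;
  atlas_homeo : forall c, atlas c -> chart_homeo c;
  atlas_compatible : forall c c', atlas c -> atlas c' -> chart_compatible c c';
  atlas_cover : forall x, exists2 c, atlas c & cdom c x }.
Arguments atlas {R}.
Arguments mdim {R}.

Section SmoothMaps.
Context {R : realType}.
Implicit Types M N : manifold R.

(* membership in C^oo(M) *)
Definition smooth_fun M (f : M -> R) : Prop :=
  forall c, atlas M c -> smooth_on (cimg c) (f \o cinv c : 'rV[R]_(mdim M) -> R^o).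

Definition smooth_map M N (F : M -> N) : Prop :=
  continuous F /\
  forall c c', atlas M c -> atlas N c' ->
    smooth_on (cfwd c @` (cdom c `&` F @^-1` cdom c'))
              (cfwd c' \o F \o cinv c).

(* smoothness of a map M1 x M2 -> N, in product charts of M1 x M2 *)
Definition smooth_map2 M1 M2 N (F : M1 -> M2 -> N) : Prop :=
  continuous (fun p : M1 * M2 => F p.1 p.2) /\
  forall c1 c2 c', atlas M1 c1 -> atlas M2 c2 -> atlas N c' ->
    smooth_on [set v : 'rV[R]_(mdim M1) * 'rV[R]_(mdim M2) |
                 [/\ cimg c1 v.1, cimg c2 v.2 &
                     cdom c' (F (cinv c1 v.1) (cinv c2 v.2))]]
              (fun v => cfwd c' (F (cinv c1 v.1) (cinv c2 v.2))).

Definition smooth_curve M (gamma : R -> M) : Prop :=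
  continuous gamma /\
  forall c, atlas M c ->
    smooth_on (gamma @^-1` cdom c : set R^o) (cfwd c \o gamma).

(* Tangent vectors at [m] are the derivations of C^oo(M) at [m].  A functional
   is only ever evaluated on smooth functions; two functionals represent the
   same tangent vector iff they agree there. *)
Definition tangent_vector M (m : M) (v : (M -> R) -> R) : Prop :=
  (forall (a : R) (f g : M -> R), smooth_fun f -> smooth_fun g ->
     v (a *: f + g) = a * v f + v g) /\
  (forall f g : M -> R, smooth_fun f -> smooth_fun g ->
     v (f * g) = v f * g m + f m * v g).

(* [P f g] stands for P(df, dg).  At each point P is an element
   \sum_i u_i /\ v_i of \bigwedge^2 T_m M, with
   u /\ v = u (x) v - v (x) u. *)
Definition bivector_field M (P : (M -> R) -> (M -> R) -> M -> R) : Prop :=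
  (forall m, exists k (u v : 'I_k -> (M -> R) -> R),
     (forall i, tangent_vector m (u i) /\ tangent_vector m (v i)) /\
     (forall f g, smooth_fun f -> smooth_fun g ->
        P f g m = \sum_(i < k) (u i f * v i g - v i f * u i g))) /\
  (forall f g, smooth_fun f -> smooth_fun g -> smooth_fun (P f g)).

(* (1/2)[P, P](df, dg, dh) for the Schouten bracket: this formula is its
   normalization, and determines it. *)
Definition half_schouten M (P : (M -> R) -> (M -> R) -> M -> R)
    (f g h : M -> R) : M -> R :=
  P f (P g h) + P g (P h f) + P h (P f g).

(* (L_X P)(df, dg), where X acts on functions *)
Definition lie_derivative M (X : (M -> R) -> M -> R)
    (P : (M -> R) -> (M -> R) -> M -> R) (f g : M -> R) : M -> R :=
  X (P f g) - P (X f) g - P f (X g).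

(* [A] is meant to be a subalgebra of C^oo(M). *)
Definition poisson_bracket M (A : set (M -> R))
    (br : (M -> R) -> (M -> R) -> M -> R) : Prop :=
  [/\ forall f g, A f -> A g -> A (br f g),
      forall (a : R) f g h, A f -> A g -> A h ->
        br (a *: f + g) h = a *: br f h + br g h,
      forall f g, A f -> A g -> br f g = - br g f,
      forall f g h, A f -> A g -> A h ->
        br f (g * h) = br f g * h + g * br f h &
      forall f g h, A f -> A g -> A h ->
        br f (br g h) + br g (br h f) + br h (br f g) = 0].

End SmoothMaps.

Record lieGroup (R : realType) := LieGroup {
  lgmanifold :> manifold R;
  lgmul : lgmanifold -> lgmanifold -> lgmanifold;
  lginv : lgmanifold -> lgmanifold;
  lgone : lgmanifold;
  lgmulA : associative lgmul;
  lgmul1 : left_id lgone lgmul;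
  lgmulV : left_inverse lgone lginv lgmul;
  lgmul_smooth : smooth_map2 lgmul;
  lginv_smooth : smooth_map lginv }.
Arguments lgone {R}.

Record lieAlgebra (R : realType) := LieAlgebra {
  laspace :> vectType R;
  labr : {bilinear laspace -> laspace -> laspace};
  labr_alt : forall x, labr x x = 0;
  labr_jacobi : forall x y z,
    labr x (labr y z) + labr y (labr z x) + labr z (labr x y) = 0 }.

Section LieTheory.
Context {R : realType}.

(* left- and right-invariant vector fields with value [v] at the identity *)
Definition left_invariant (G : lieGroup R) (v : (G -> R) -> R)
    (f : G -> R) (g : G) : R := v (fun k => f (lgmul g k)).

Definition right_invariant (G : lieGroup R) (v : (G -> R) -> R)
    (f : G -> R) (g : G) : R := v (fun k => f (lgmul k g)).

(* [tan] identifies the vector space [L] with T_e G and the bracket [br] with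
   the commutator of left-invariant vector fields, evaluated at e. *)
Definition lie_algebra_of (G : lieGroup R) (L : vectType R) (br : L -> L -> L)
    (tan : L -> (G -> R) -> R) : Prop :=
  [/\ forall x, tangent_vector (lgone G) (tan x),
      forall (a : R) x y (f : G -> R), smooth_fun f ->
        tan (a *: x + y) f = a * tan x f + tan y f,
      forall x y, (forall f, smooth_fun f -> tan x f = tan y f) -> x = y,
      forall v, tangent_vector (lgone G) v ->
        exists x, forall f, smooth_fun f -> tan x f = v f &
      forall x y (f : G -> R), smooth_fun f ->
        tan (br x y) f = tan x (left_invariant (tan y) f)
                         - tan y (left_invariant (tan x) f)].

(* The exponential map of [G]: t |-> exp(tx) is the one-parameter subgroup
   with initial velocity [x].  This property determines [exp]. *)
Definition exponential_map (G : lieGroup R) (L : vectType R)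
    (tan : L -> (G -> R) -> R) (exp : L -> G) : Prop :=
  forall x : L,
    [/\ smooth_curve (fun t : R => exp (t *: x)),
        forall s t : R,
          exp ((s + t) *: x) = lgmul (exp (s *: x)) (exp (t *: x)) &
        forall f : G -> R, smooth_fun f ->
          is_derive (0 : R^o) 1 (fun t : R^o => f (exp (t *: x)) : R^o)
            (tan x f)].

(* [iota] is the inclusion of a closed (hence embedded) Lie subgroup. *)
Definition closed_lie_subgroup (G D : lieGroup R) (iota : G -> D) : Prop :=
  [/\ (forall a b, iota (lgmul a b) = lgmul (iota a) (iota b)) /\ injective iota,
      smooth_map iota,
      forall g v, tangent_vector g v ->
        (forall f : D -> R, smooth_fun f -> v (f \o iota) = 0) ->
        forall f : G -> R, smooth_fun f -> v f = 0,
      forall U : set G, open U -> exists2 V : set D, open V & U = iota @^-1` V &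
      closed (range iota)].

Section Manin.
Variables (d : lieAlgebra R) (form : {biscalar d}) (g : {vspace d}).

Definition isotropic (V : {vspace d}) : Prop :=
  forall x y, x \in V -> y \in V -> form x y = 0.

Definition split_signature (n : nat) : Prop :=
  exists b : 'I_n + 'I_n -> d,
    [/\ <<[seq b i | i : 'I_n + 'I_n]>>%VS = fullv,
        forall i j, form (b (inl i)) (b (inl j)) = (i == j)%:R,
        forall i j, form (b (inr i)) (b (inr j)) = - (i == j)%:R &
        forall i j, form (b (inl i)) (b (inr j)) = 0].

Definition manin_pair (n : nat) : Prop :=
  [/\ \dim {: d} = n.*2,
      [/\ forall x y, form x y = form y x,
          forall x, (forall y, form x y = 0) -> x = 0,
          forall x y z, form (labr d x y) z = form x (labr d y z) &
          split_signature n],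
      forall x y, x \in g -> y \in g -> labr d x y \in g,
      isotropic g &
      forall V : {vspace d}, isotropic V -> (g <= V)%VS -> V = g].

Definition isotropic_complement (h : {vspace d}) : Prop :=
  [/\ (g :&: h = 0)%VS, (g + h = fullv)%VS & isotropic h].

Definition gdual : Type := 'Hom(subvs_of g, R^o).

Definition proj_g (h : {vspace d}) (x : d) : subvs_of g :=
  vsproj g (daddv_pi g h x).

Definition proj_h (h : {vspace d}) (x : d) : d := daddv_pi h g x.

(* j : g^* -> h, the unique element of [h] with (j xi | x) = <xi, x> on [g] *)
Definition jmap (h : {vspace d}) (xi : gdual) : d :=
  xget 0 [set y : d | y \in h /\ forall x : subvs_of g, form y (vsval x) = xi x].

(* j^-1 : h -> g^* *)
Definition jinv (y : d) : gdual :=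
  linfun (fun x : subvs_of g => form y (vsval x) : R^o).

Definition Fmap (h : {vspace d}) (x : subvs_of g) (xi eta : gdual) : R :=
  jinv (proj_h h (labr d (jmap h xi) (jmap h eta))) x.

Definition phi (h : {vspace d}) (xi eta zeta : gdual) : R :=
  zeta (proj_g h (labr d (jmap h xi) (jmap h eta))).

(* j' xi - j xi lies in [g] *)
Definition twist (h h' : {vspace d}) (xi eta : gdual) : R :=
  eta (vsproj g (jmap h' xi - jmap h xi)).

Definition gbasis := vbasis {: subvs_of g}.

Definition gdual_basis (i : 'I_(\dim {: subvs_of g})) : gdual :=
  linfun (coord gbasis i : subvs_of g -> R^o).

(* The scalar product on the group with Lie algebra [d] obtained from [form] by
   left translations is the one obtained by right translations. *)
Definition bi_invariant (D : lieGroup R) (tan : d -> (D -> R) -> R) : Prop :=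
  forall (a : D) x y x' y',
    (forall f, smooth_fun f ->
       left_invariant (tan x) f a = right_invariant (tan x') f a) ->
    (forall f, smooth_fun f ->
       left_invariant (tan y) f a = right_invariant (tan y') f a) ->
    form x y = form x' y'.

End Manin.

(* (D, G), together with models of the Lie algebras: [gp_d] for D, and its
   subspace [gp_g] for G, compatibly with the differential of G -> D. *)
Record groupPair := GroupPair {
  gp_D : lieGroup R;
  gp_G : lieGroup R;
  gp_iota : gp_G -> gp_D;
  gp_n : nat;
  gp_d : lieAlgebra R;
  gp_form : {biscalar gp_d};
  gp_g : {vspace gp_d};
  gp_tanD : gp_d -> (gp_D -> R) -> R;
  gp_tanG : subvs_of gp_g -> (gp_G -> R) -> R;
  gp_D_connected : connected [set: gp_D];
  gp_G_connected : connected [set: gp_G];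
  gp_subgroup : closed_lie_subgroup gp_iota;
  gp_manin : manin_pair gp_form gp_g gp_n;
  gp_lieD : lie_algebra_of (labr gp_d) gp_tanD;
  gp_lieG : lie_algebra_of
    (fun x y : subvs_of gp_g => vsproj gp_g (labr gp_d (vsval x) (vsval y)))
    gp_tanG;
  gp_tan_compat : forall (x : subvs_of gp_g) (f : gp_D -> R), smooth_fun f ->
    gp_tanG x (f \o gp_iota) = gp_tanD (vsval x) f;
  gp_bi_invariant : bi_invariant gp_form gp_tanD }.

Definition smooth_action (G : lieGroup R) (M : manifold R) (act : G -> M -> M)
    : Prop :=
  [/\ forall m, act (lgone G) m = m,
      forall a b m, act (lgmul a b) m = act a (act b m) &
      smooth_map2 act].

(* C^oo(M)^G *)
Definition invariant_fun (G : lieGroup R) (M : manifold R) (act : G -> M -> M)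
    : set (M -> R) :=
  [set f | smooth_fun f /\ forall a m, f (act a m) = f m].

Section Action.
Variables (gp : groupPair) (exp : subvs_of (gp_g gp) -> gp_G gp).
Variables (M : manifold R) (act : gp_G gp -> M -> M).
Let form := gp_form gp.
Let g := gp_g gp.
Let e := gbasis g.
Let eps := @gdual_basis (gp_d gp) g.

(* x_M *)
Definition fund_field (x : subvs_of g) (f : M -> R) (m : M) : R :=
  derive1 (fun t : R^o => f (act (exp (- t *: x)) m) : R^o) 0.

(* a_M for a in \bigwedge^2 g, resp. \bigwedge^3 g, viewed as a form on g^*;
   as a tensor, a = \sum_ij a(eps^i, eps^j) e_i (x) e_j. *)
Definition mult_ext2 (a : gdual g -> gdual g -> R) (f1 f2 : M -> R) (m : M)
    : R :=
  \sum_i \sum_j a (eps i) (eps j) *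
    (fund_field e`_i f1 m * fund_field e`_j f2 m).

Definition mult_ext3 (a : gdual g -> gdual g -> gdual g -> R)
    (f1 f2 f3 : M -> R) (m : M) : R :=
  \sum_i \sum_j \sum_k a (eps i) (eps j) (eps k) *
    (fund_field e`_i f1 m * fund_field e`_j f2 m * fund_field e`_k f3 m).

Definition quasi_poisson_action (h : {vspace gp_d gp})
    (P : (M -> R) -> (M -> R) -> M -> R) : Prop :=
  (forall f1 f2 f3, smooth_fun f1 -> smooth_fun f2 -> smooth_fun f3 ->
     half_schouten P f1 f2 f3 = mult_ext3 (@phi _ form g h) f1 f2 f3) /\
  (forall (x : subvs_of g) f1 f2, smooth_fun f1 -> smooth_fun f2 ->
     lie_derivative (fund_field x) P f1 f2
     = - mult_ext2 (@Fmap _ form g h x) f1 f2).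

(* P^h' = P^h - t_M *)
Definition twisted_bivector (h h' : {vspace gp_d gp})
    (P : (M -> R) -> (M -> R) -> M -> R) (f1 f2 : M -> R) : M -> R :=
  P f1 f2 - mult_ext2 (@twist _ form g h h') f1 f2.

End Action.
End LieTheory.
Arguments groupPair : clear implicits.

(* Main.v *)
(* If f is G-invariant then x_M f = 0, so phi_M, F(x)_M and t_M vanish on
   invariant functions; this gives the Jacobi identity, the independence of
   the complement, and x_M {f1, f2} = 0 for all x in g.  To conclude that
   b = {f1, f2} is G-invariant, consider k |-> b (k m) on G: it is smooth and
   killed by the right-invariant vector fields, which span every tangent space
   of G, so it is locally constant, hence constant since G is connected. *)
Require Import Defs.
From HB Require Import structures.
From mathcomp Require Import all_boot all_order all_algebra.
From mathcomp Require Import all_classical all_reals all_analysis.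
From mathcomp Require Import ring.
Import Order.TTheory GRing.Theory Num.Theory.
Import numFieldNormedType.Exports.
Local Open Scope classical_set_scope.
Local Open Scope ring_scope.

(** * Calculus of C^k maps between normed spaces *)

Section Ck.
Context {R : realType}.

Lemma differentiable_near {V W : normedModType R} {f g : V -> W} {x : V} :
  (\forall y \near x, f y = g y) -> differentiable f x -> differentiable g x.
Proof.
move=> fg /diff_locallyP [dfc dfx].
(* The first-order expansion of [f] carries over to [g]; uniqueness of the differential then gives
   ['d g x = 'd f x]. *)
have gx : g \o shift x = cst (g x) + 'd f x +o_ 0 id.
  apply/eqaddoP => e e0; have /eqaddoP/(_ e e0) := dfx.
  have : \forall h \near 0, f (h + x) = g (h + x).
    move: fg; rewrite (near_shift 0); apply: filterS => h /=.
    by rewrite subr0.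
  have fgx := nbhs_singleton fg; rewrite /= in fgx.
  rewrite !near_simpl; apply: filterS2 => h /= fgh.
  by rewrite -![(_ + _ : _ -> _) _]/(_ + _) -![(- _ : _ -> _) _]/(- _)
     -![(_ + _ : _ -> _) _]/(_ + _) /= /cst /shift /= fgh fgx.
have dgE := @diff_unique _ _ _ g ('d f x) x dfc gx.
by apply/diff_locallyP; rewrite dgE.
Qed.

Lemma Ck_on_sub {V W : normedModType R} {k} {S T : set V} {f : V -> W} :
  S `<=` T -> Ck_on k T f -> Ck_on k S f.
Proof.
move=> ST; elim: k f => [|k IH] f /=; first by move=> fT x /ST /fT.
by move=> [dT DT]; split=> [x /ST /dT //|v]; exact: IH.
Qed.

(** Continuity and derivatives are taken in the whole space [V], so each clause of [Ck_on] is a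
    condition at a single point. This permits a choice of chart that depends on the point. *)
Lemma Ck_on_point {V W : normedModType R} {k} {S : set V} {f : V -> W} :
  (forall x, S x -> Ck_on k [set x] f) -> Ck_on k S f.
Proof.
elim: k f => [|k IH] f /= fS; first by move=> x /fS; exact.
by split=> [x /fS [+ _]|v]; [exact | apply: IH => x /fS [_ /(_ v)]].
Qed.

(** An equality near [x] also holds near every point close to [x]; hence it passes to directional
    derivatives, and the induction can proceed. *)
Lemma Ck_on_near {V W : normedModType R} {k} {S : set V} {f g : V -> W} :
  (forall x, S x -> \forall y \near x, f y = g y) ->
  Ck_on k S f -> Ck_on k S g.
Proof.
elim: k f g => [|k IH] f g /= fg.
  move=> fS x Sx; have fgx := nbhs_singleton (fg x Sx).
  move: (fS x Sx); rewrite /prop_for /continuous_at /= -fgx => fc.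
  by apply: cvg_trans fc; apply: near_eq_cvg; exact: fg.
move=> [fd fD]; split=> [x Sx|v].
  exact: differentiable_near (fg x Sx) (fd x Sx).
apply: IH (fD v) => x Sx; have /near_join := fg x Sx.
apply: filterS => y fgy; exact: near_eq_derive.
Qed.

Lemma Ck_onW {V W : normedModType R} {k} {S : set V} {f : V -> W} :
  Ck_on k.+1 S f -> Ck_on k S f.
Proof.
elim: k f => [|k IH] f [fd fD]; first by move=> x /fd;
  exact: differentiable_continuous.
by split=> // v; exact: IH (fD v).
Qed.

Lemma Ck_on_cst {V W : normedModType R} k (S : set V) (a : W) :
  Ck_on k S (cst a).
Proof.
elim: k a => [|k IH] a /=; first by move=> x _; exact: cst_continuous.
split=> [x _|v]; first exact: differentiable_cst.
rewrite (_ : 'D_v (cst a) = cst 0); first exact: IH.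
by apply/funext => x; rewrite derive_cst.
Qed.

Lemma Ck_onD {V W : normedModType R} {k} {S : set V} {f g : V -> W} :
  open S -> Ck_on k S f -> Ck_on k S g -> Ck_on k S (f + g).
Proof.
move=> oS; elim: k f g => [|k IH] f g /=.
  by move=> fS gS x Sx; apply: continuousD; [exact: fS | exact: gS].
move=> [fd fD] [gd gD]; split=> [x Sx|v].
  by apply: differentiableD; [exact: fd | exact: gd].
apply: Ck_on_near (IH _ _ (fD v) (gD v)) => x Sx.
apply: filterS (open_nbhs_nbhs (conj oS Sx)) => y Sy.
by rewrite deriveD //; apply: diff_derivable; [exact: fd | exact: gd].
Qed.

Lemma Ck_onM {V : normedModType R} {k} {S : set V} {f g : V -> R} :
  open S -> Ck_on k S (f : V -> R^o) -> Ck_on k S (g : V -> R^o) ->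
  Ck_on k S (f * g : V -> R^o).
Proof.
move=> oS; elim: k f g => [|k IH] f g.
  by move=> fS gS x Sx; apply: continuousM; [exact: fS | exact: gS].
move=> fS gS; have [fd fD] := fS; have [gd gD] := gS; split=> [x Sx|v].
  by apply: differentiableM; [exact: fd | exact: gd].
apply: Ck_on_near
  (Ck_onD oS (IH _ _ (Ck_onW fS) (gD v)) (IH _ _ (Ck_onW gS) (fD v))) => x Sx.
apply: filterS (open_nbhs_nbhs (conj oS Sx)) => y Sy.
by rewrite deriveM //; apply: diff_derivable; [exact: fd | exact: gd].
Qed.

Lemma Ck_on_sum {V W : normedModType R} {k n} {S : set V}
    {f : 'I_n -> V -> W} :
  open S -> (forall i, Ck_on k S (f i)) -> Ck_on k S (\sum_i f i).
Proof.
move=> oS fS; elim/big_ind: _ => //; first exact: Ck_on_cst.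
by move=> ? ?; exact: Ck_onD.
Qed.

Lemma Ck_on_coord {V : normedModType R} {k n} {S : set V}
    {f : V -> 'rV[R]_n} (i : 'I_n) :
  open S -> Ck_on k S f -> Ck_on k S (fun x => f x 0 i : R^o).
Proof.
move=> oS; elim: k f => [|k IH] f.
  move=> fS x Sx; apply: (@continuous_comp _ _ _ f (fun M => M 0 i)).
    exact: fS.
  exact: coord_continuous.
move=> [fd fD]; split=> [x Sx|v].
  apply: (@differentiable_comp _ _ _ _ f (fun M => M 0 i)); first exact: fd.
  exact: differentiable_coord.
apply: Ck_on_near (IH _ (fD v)) => x Sx.
apply: filterS (open_nbhs_nbhs (conj oS Sx)) => y Sy.
by rewrite (derive_mx (diff_derivable (fd y Sy))) mxE.
Qed.

(** The chain rule differentiates [g] in the direction ['D_v f x], which moves with [x], whereas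
    [Ck_on] controls fixed directions only. Expanding in the standard basis reduces to those. *)
Lemma derive_comp_coord {V W : normedModType R} {n} {f : V -> 'rV[R]_n}
    {g : 'rV[R]_n -> W} {x v : V} :
  differentiable f x -> differentiable g (f x) ->
  'D_v (g \o f) x = \sum_i 'D_v f x 0 i *: 'D_(delta_mx 0 i) g (f x).
Proof.
move=> fd gd; rewrite deriveE; last exact: differentiable_comp.
rewrite diff_comp //= -[in LHS](deriveE v fd).
rewrite {1}(row_sum_delta ('D_v f x)) linear_sum.
by apply: eq_bigr => i _; rewrite linearZ /= -(deriveE _ gd).
Qed.

Lemma Ck_on_comp {V : normedModType R} {k n} {S : set V} {T : set 'rV[R]_n}
    {f : V -> 'rV[R]_n} {g : 'rV[R]_n -> R^o} :
  open S -> (forall x, S x -> T (f x)) ->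
  Ck_on k S f -> Ck_on k T g -> Ck_on k S (g \o f).
Proof.
move=> oS fST; elim: k f g fST => [|k IH] f g fST.
  by move=> fS gT x Sx; apply: continuous_comp; [exact: fS|exact/gT/fST].
move=> fS; have [fd fD] := fS => -[gd gD]; split=> [x Sx|v].
  by apply: differentiable_comp; [exact: fd|exact/gd/fST].
(* Every factor of the chain rule is C^k: the coordinates of ['D_v f] directly, the partial
   derivatives of [g] composed with [f] by induction. *)
have DS : Ck_on k S (\sum_i ((fun x => 'D_v f x 0 i) *
                          ('D_(delta_mx 0 i) g \o f)) : V -> R^o).
  apply: Ck_on_sum => // i; apply: Ck_onM => //.
    exact: (Ck_on_coord i oS (fD v)).
  exact: IH _ _ fST (Ck_onW fS) (gD _).
apply: Ck_on_near DS => x Sx.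
apply: filterS (open_nbhs_nbhs (conj oS Sx)) => y Sy.
rewrite derive_comp_coord; [|exact: fd|exact/gd/fST].
by rewrite fct_sumE.
Qed.

Lemma Ck_on_slice {V1 V2 W : normedModType R} {k} {S : set (V1 * V2)%type}
    {f : (V1 * V2)%type -> W} (q : V2) :
  Ck_on k S f -> Ck_on k [set y | S (y, q)] (fun y => f (y, q)).
Proof.
elim: k f => [|k IH] f.
  move=> fS x Sx; apply: (@continuous_comp _ _ _ (fun y => (y, q)) f);
    last exact: fS.
  by apply: cvg_pair; [exact: cvg_id|exact: cvg_cst].
move=> [fd fD]; split=> [x Sx|v].
  apply: (@differentiable_comp _ _ _ _ (fun y => (y, q)) f); last exact: fd.
  by apply: (@differentiable_pair _ _ _ _ id (cst q)) => //;
    exact: differentiable_cst.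
(* Differentiating the slice along [v] is differentiating [f] along [(v, 0)]: the difference
   quotients coincide. *)
rewrite (_ : 'D_v _ = fun y => 'D_(v, 0) f (y, q)); first exact: IH (fD _).
apply/funext => y; rewrite /derive.
rewrite (_ : (fun t : R => t^-1 *: (((fun y0 => f (y0, q)) \o shift y) (t *: v)
    - f (y, q))) = (fun t => t^-1 *: ((f \o shift (y, q)) (t *: (v, 0 : V2))
    - f (y, q)))) //.
apply/funext => t /=; congr (_ *: (f _ - _)).
by rewrite /shift /=; congr pair; rewrite /= scaler0 add0r.
Qed.

End Ck.

(** * Smooth functions, tangent vectors and connectedness on manifolds *)

Section Manifolds.
Context {R : realType}.
Implicit Types M N : manifold R.

(** Mean value theorem for [f] along the segment from [x] to [y], which stays in the ball. *)
Lemma zero_derive_ball {V : normedModType R} {f : V -> R^o} {x : V} {e : R} :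
  (forall y, ball x e y -> differentiable f y) ->
  (forall v y, ball x e y -> 'D_v f y = 0) ->
  forall y, ball x e y -> f y = f x.
Proof.
move=> fd fD y xey; pose w := y - x; pose h (s : R) : R := f (s *: w + x).
have ball_seg (s : R) : s \in `[0, 1]%R -> ball x e (s *: w + x).
  rewrite in_itv /= => /andP[s0 s1].
  move: xey; rewrite -!ball_normE /ball_ /= => xey.
  rewrite opprD addrCA subrr addr0 normrN normrZ ger0_norm //.
  by rewrite (le_lt_trans _ xey) // /w distrC ler_piMl.
have hD (s : R) : s \in `[0, 1]%R -> is_derive s 1 h 0.
  move=> s01; have := ball_seg s s01 => xs.
  (* The difference quotients of [h] at [s] are those of [f] at [s *: w + x] in the direction [w],
     so no chain rule is called for. *)
  have hE : (fun t : R => t^-1 *: ((h \o shift s) (t *: 1) - h s)) =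
    (fun t => t^-1 *: ((f \o shift (s *: w + x)) (t *: w) - f (s *: w + x))).
    apply/funext => t; congr (_ *: (f _ - _)).
    by rewrite /shift /= [_ *: 1]mulr1 scalerDl addrA.
  split; first by rewrite /derivable hE; exact: diff_derivable (fd _ xs).
  by rewrite /derive hE; exact: fD.
have hc : {within `[0, 1], continuous h}.
  by apply: derivable_within_continuous => s /hD [].
have hD' (s : R) : s \in `]0, 1[%R -> is_derive s 1 h 0.
  by move=> s01; apply: hD; exact: subset_itv_oo_cc.
have [s _] := MVT_segment ler01 hD' hc.
rewrite mul0r /h scale1r scale0r add0r subrK.
by move/eqP; rewrite subr_eq0 => /eqP.
Qed.

Lemma smooth_fun_cst M (a : R) : @smooth_fun R M (cst a).
Proof. by move=> c Ac k; exact: Ck_on_cst. Qed.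

Lemma smooth_funM {M} {f g : M -> R} :
  smooth_fun f -> smooth_fun g -> smooth_fun (f * g).
Proof.
move=> fS gS c Ac k; have [_ oc _ _ _] := atlas_homeo Ac.
by have := Ck_onM oc (fS c Ac k) (gS c Ac k).
Qed.

Lemma smooth_funD {M} {f g : M -> R} :
  smooth_fun f -> smooth_fun g -> smooth_fun (f + g).
Proof.
move=> fS gS c Ac k; have [_ oc _ _ _] := atlas_homeo Ac.
by have := Ck_onD oc (fS c Ac k) (gS c Ac k).
Qed.

Lemma smooth_funZ {M} (a : R) {f : M -> R} :
  smooth_fun f -> smooth_fun (a *: f).
Proof. by move=> fS; have := smooth_funM (smooth_fun_cst M a) fS. Qed.

Lemma smooth_fun_differentiable {M} {f : M -> R} {c} {y : 'rV[R]_(mdim M)} :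
  smooth_fun f -> atlas M c -> cimg c y ->
  differentiable (f \o cinv c : 'rV[R]_(mdim M) -> R^o) y.
Proof. by move=> fS /fS /(_ 1%N) [+ _]; apply. Qed.

(** Coordinate derivatives are derivations at [m]; thus a smooth function killed by all tangent
    vectors has zero derivative in every chart. *)
Lemma chart_tangent_vector {M} {m : M} {c} (v : 'rV[R]_(mdim M)) :
  atlas M c -> cdom c m ->
  tangent_vector m
    (fun f : M -> R => 'D_v (f \o cinv c : _ -> R^o) (cfwd c m)).
Proof.
move=> Ac cm; have [_ oc cK _ _] := atlas_homeo Ac.
have icm : cimg c (cfwd c m) by exists m.
have dv f : smooth_fun f -> derivable (f \o cinv c : _ -> R^o) (cfwd c m) v.
  move=> fS; exact: diff_derivable (smooth_fun_differentiable fS Ac icm).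
split=> [a f g fS gS | f g fS gS].
  have := deriveD (derivableZ (k := a) (dv f fS)) (dv g gS).
  by rewrite deriveZ; [exact|exact: dv].
have := deriveM (dv f fS) (dv g gS).
by rewrite /= cK // => ->; rewrite addrC mulrC.
Qed.

(** In a chart, [zero_derive_ball] makes [f] locally constant; its level sets are then open and
    closed. *)
Lemma smooth_fun_constant {M} {f : M -> R} :
  connected [set: M] -> smooth_fun f ->
  (forall m v, tangent_vector m v -> v f = 0) -> forall a b, f a = f b.
Proof.
move=> Mc fS f0.
have loc m : \forall m' \near m, f m' = f m.
  have [c Ac cm] := atlas_cover m; have [oc oi cK cc _] := atlas_homeo Ac.
  have icm : cimg c (cfwd c m) by exists m.
  have /nbhs_ballP[e /= e0 ce] : nbhs (cfwd c m) (cimg c).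
    exact: open_nbhs_nbhs (conj oi icm).
  have fb := @zero_derive_ball _ (f \o cinv c : _ -> R^o) (cfwd c m) e.
  have {}fb : forall y, ball (cfwd c m) e y -> f (cinv c y) = f m.
    move=> y yb; rewrite -[in RHS](cK m cm); apply: fb yb => [z|v z] /ce.
      exact: smooth_fun_differentiable.
    by move=> [m' cm' <-]; exact: f0 (chart_tangent_vector v Ac cm').
  have nb : \forall m' \near m, ball (cfwd c m) e (cfwd c m').
    by apply: (cc m cm); exact: nbhsx_ballx.
  apply: filterS2 (open_nbhs_nbhs (conj oc cm)) nb => m' cm' /fb.
  by rewrite cK.
(* Any preimage under a locally constant function is open; this serves for the level set of [f b]
   and for its complement. *)
move=> a b; have ofa (Q : R -> Prop) : open [set m | Q (f m)].
  rewrite openE => m Qm; rewrite /interior /=; apply: filterS (loc m) => m' /= ->.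
  exact: Qm.
suff fb : [set m | f m = f b] = [set: M].
  by rewrite -[f a = f b]/([set m | f m = f b] a) fb.
apply: Mc; first by exists b.
  by exists [set m | f m = f b]; [exact: (ofa (fun r => r = f b))|rewrite setTI].
exists [set m | f m = f b]; last by rewrite setTI.
by rewrite -openC; exact: (ofa (fun r => ~ r = f b)).
Qed.

(** One chart around [q] is enough, but the chart of [N] has to follow the value [F p q]; hence the
    reduction to a single point [y] and to the neighbourhood [U] on which the chart [c'] is
    usable. *)
Lemma smooth_fun_slice {M1 M2 N : manifold R} {F : M1 -> M2 -> N} (q : M2)
    {f : N -> R} :
  smooth_map2 F -> smooth_fun f -> smooth_fun (fun p => f (F p q)).
Proof.
move=> [Fc FS] fS c Ac k; apply: Ck_on_point => y cy.
have [_ oi _ _ cc] := atlas_homeo Ac.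
have [c2 Ac2 c2q] := atlas_cover q; have [_ _ c2K _ _] := atlas_homeo Ac2.
have [c' Ac' c'y] := atlas_cover (F (cinv c y) q).
have [oc' _ c'K _ _] := atlas_homeo Ac'.
pose G z := F (cinv c z) q.
pose U := [set z | cimg c z /\ cdom c' (G z)].
have oU : open U.
  rewrite openE => z [cz c'z]; rewrite /interior.
  have Gc : {for z, continuous G}.
    apply: (@continuous_comp _ _ _ (fun z => (cinv c z, q)) (fun p => F p.1 p.2)).
      by apply: (cvg_pair (F := nbhs z)); [exact: (cc z cz)|exact: cvg_cst].
    exact: Fc.
  have /Gc Gz : nbhs (G z) (cdom c') by exact: open_nbhs_nbhs.
  by apply: filterS2 (open_nbhs_nbhs (conj oi cz)) Gz => z' ? ?; split.
have GS : Ck_on k U (fun z => cfwd c' (G z)).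
  have := Ck_on_slice (cfwd c2 q) (FS c c2 c' Ac Ac2 Ac' k).
  rewrite /= c2K //; apply: Ck_on_sub => z [cz c'z] /=.
  by split => //; exists q.
have fGS : Ck_on k U ((f \o cinv c') \o (fun z => cfwd c' (G z)) : _ -> R^o).
  apply: Ck_on_comp oU _ GS (fS c' Ac' k) => z [_ c'z]; exact: imageP.
have Uy : U y by [].
apply: Ck_on_near (Ck_on_sub _ fGS) => [z -> /=|z -> //].
by apply: filterS (open_nbhs_nbhs (conj oU Uy)) => z' [_ /c'K /= ->].
Qed.

End Manifolds.

(** * Right translations, fundamental vector fields and invariant functions *)

Section Actions.
Context {R : realType}.

Lemma lgmulrV (G : lieGroup R) (a : G) : lgmul a (lginv a) = lgone G.
Proof.
rewrite -[LHS](lgmul1 (l := G)) -(lgmulV (lginv a)) -lgmulA.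
by rewrite [lgmul (lginv a) (lgmul _ _)]lgmulA lgmulV lgmul1.
Qed.

(** The group axioms are one-sided: the right unit law is reached by writing the unit as
    [lgmul (lginv k) k]. *)
Lemma lgmulrKV (G : lieGroup R) (k a : G) : lgmul (lgmul k (lginv a)) a = k.
Proof. by rewrite -lgmulA lgmulV -(lgmulV k) lgmulA lgmulrV lgmul1. Qed.

(** Right translation by the inverse of [a] carries [v] to the identity, which exhibits [v] as the
    value at [a] of a right-invariant field. *)
Lemma tangent_vector_translate {G : lieGroup R} {a : G} {v} :
  tangent_vector a v ->
  tangent_vector (lgone G) (fun f : G -> R => v (fun k => f (lgmul k (lginv a)))).
Proof.
move=> [vL vM]; have sm f : smooth_fun f ->
    smooth_fun (fun k : G => f (lgmul k (lginv a))).
  exact: (smooth_fun_slice (lginv a) (lgmul_smooth G)).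
split=> [c f g fS gS|f g fS gS]; first exact: vL (sm f fS) (sm g gS).
by have := vM _ _ (sm f fS) (sm g gS); rewrite lgmulrV.
Qed.

Section FundField.
Context {gp : groupPair R} {exp : subvs_of (gp_g gp) -> gp_G gp}.
Context {M : manifold R} {act : gp_G gp -> M -> M}.

Lemma fund_field_invariant x {f : M -> R} :
  invariant_fun act f -> fund_field exp act x f = 0.
Proof.
move=> [_ fI]; apply/funext => m; rewrite /fund_field.
rewrite (_ : (fun t : R => _) = cst (f m)); first exact: derive1_cst.
by apply/funext => t; exact: fI.
Qed.

Lemma fund_field_eq0_invariant {F : M -> R} :
  exponential_map (@gp_tanG R gp) exp -> smooth_action act -> smooth_fun F ->
  (forall x, fund_field exp act x F = 0) -> invariant_fun act F.
Proof.
move=> Hexp [act1 actM actS] FS F0; split=> // a m.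
pose f k := F (act k m).
have fS : smooth_fun f := smooth_fun_slice m actS FS.
(* The claim becomes equality of the values of the orbit function [f] at [a] and at the identity. *)
rewrite -[RHS](congr1 F (act1 m)).
apply: (smooth_fun_constant (@gp_G_connected R gp) fS) => {}a v va.
have [_ _ _ tan_surj _] := @gp_lieG R gp.
have [x xE] := tan_surj _ (tangent_vector_translate va).
have faS : smooth_fun (fun k => f (lgmul k a)).
  exact: (smooth_fun_slice a (lgmul_smooth (gp_G gp))).
have [_ _ /(_ _ faS) [_ xD]] := Hexp x.
have := xE _ faS.
rewrite (_ : (fun k => f (lgmul (lgmul k (lginv a)) a)) = f); last first.
  by apply/funext => k; rewrite lgmulrKV.
move=> <-; rewrite -xD -derive1E.
(* The derivative of [f] along [v] is that of [F] along exp(tx) acting on [act a m]. Since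
   [fund_field] moves along exp(-tx), the hypothesis is applied to [- x]. *)
rewrite -[RHS](congr1 (fun g => g (act a m)) (F0 (- x))) /fund_field.
congr (derive1 _ 0); apply/funext => t.
by rewrite /f actM scaleNr scalerN opprK.
Qed.

End FundField.

Lemma mult_ext2_invariant {gp : groupPair R} {exp : subvs_of (gp_g gp) -> gp_G gp}
    {M : manifold R} {act : gp_G gp -> M -> M} a {f1 f2 : M -> R} :
  invariant_fun act f1 -> mult_ext2 exp act a f1 f2 = 0.
Proof.
move=> f1I; apply/funext => m; rewrite /mult_ext2 big1 // => i _.
by rewrite big1 // => j _; rewrite fund_field_invariant // mul0r mulr0.
Qed.

Lemma mult_ext3_invariant {gp : groupPair R} {exp : subvs_of (gp_g gp) -> gp_G gp}
    {M : manifold R} {act : gp_G gp -> M -> M} a {f1 f2 f3 : M -> R} :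
  invariant_fun act f1 -> mult_ext3 exp act a f1 f2 f3 = 0.
Proof.
move=> f1I; apply/funext => m; rewrite /mult_ext3 big1 // => i _.
rewrite big1 // => j _; rewrite big1 // => k _.
by rewrite fund_field_invariant // !mul0r mulr0.
Qed.

(** * A bivector field as an anti-symmetric biderivation *)

Section Bivector.
Context {M : manifold R} {P : (M -> R) -> (M -> R) -> M -> R}.
Context (HP : bivector_field P).

Lemma bivector_anti {f g} : smooth_fun f -> smooth_fun g -> P f g = - P g f.
Proof.
move=> fS gS; apply/funext => m; have [k [u [v [_ PE]]]] := HP.1 m.
rewrite -[RHS]/(- P g f m) !PE // -sumrN; apply: eq_bigr => i _.
by rewrite opprB [v i f * _]mulrC [u i f * _]mulrC.
Qed.

Lemma bivector_linear (a : R) {f g h} :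
  smooth_fun f -> smooth_fun g -> smooth_fun h ->
  P (a *: f + g) h = a *: P f h + P g h.
Proof.
move=> fS gS hS; apply/funext => m; have [k [u [v [uv PE]]]] := HP.1 m.
rewrite -[RHS]/(a * P f h m + P g h m) !PE //; last first.
  exact: smooth_funD (smooth_funZ a fS) gS.
rewrite mulr_sumr -big_split /=; apply: eq_bigr => i _.
have [[uL _] [vL _]] := uv i; rewrite uL // vL //; ring.
Qed.

Lemma bivector_leibniz {f g h} :
  smooth_fun f -> smooth_fun g -> smooth_fun h ->
  P f (g * h) = P f g * h + g * P f h.
Proof.
move=> fS gS hS; apply/funext => m; have [k [u [v [uv PE]]]] := HP.1 m.
rewrite -[RHS]/(P f g m * h m + g m * P f h m) !PE //; last first.
  exact: smooth_funM.
rewrite mulr_suml mulr_sumr -big_split /=; apply: eq_bigr => i _.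
have [[_ uM] [_ vM]] := uv i; rewrite uM // vM //; ring.
Qed.

(** Linearity at [1 *: 0 + 0] gives [P 0 f = P 0 f + P 0 f]. *)
Lemma bivector0l {f} : smooth_fun f -> P 0 f = 0.
Proof.
move=> fS; have S0 := smooth_fun_cst M 0.
have /eqP := bivector_linear 1 S0 S0 fS.
by rewrite scaler0 scale1r addr0 -subr_eq subrr => /eqP.
Qed.

End Bivector.

End Actions.

Theorem theorem4p2p2 (R : realType) (gp : groupPair R)
    (exp : subvs_of (gp_g gp) -> gp_G gp)
    (Hexp : exponential_map (@gp_tanG R gp) exp)
    (h : {vspace gp_d gp})
    (Hh : isotropic_complement (gp_form gp) (gp_g gp) h)
    (M : manifold R) (act : gp_G gp -> M -> M) (Hact : smooth_action act)
    (P : (M -> R) -> (M -> R) -> M -> R) (HP : bivector_field P)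
    (HqP : quasi_poisson_action exp act h P) :
  poisson_bracket (invariant_fun act) P /\
  (forall h' : {vspace gp_d gp},
     isotropic_complement (gp_form gp) (gp_g gp) h' ->
     forall f1 f2 : M -> R, invariant_fun act f1 -> invariant_fun act f2 ->
       twisted_bivector exp act h h' P f1 f2 = P f1 f2).
Proof.
split; last first.
  by move=> h' _ f g fI _; rewrite /twisted_bivector mult_ext2_invariant // subr0.
have [HJ HL] := HqP; split.
- move=> f g fI gI; have fS := fI.1; have gS := gI.1.
  apply: fund_field_eq0_invariant Hexp Hact (HP.2 f g fS gS) _ => x.
  (* As F(x)_M vanishes on [f] and [g], the field x_M acts on the bracket by the Leibniz rule, and
     both resulting terms have a zero entry. *)
  have := HL x f g fS gS; rewrite mult_ext2_invariant // oppr0 /lie_derivative.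
  rewrite (fund_field_invariant x fI) (fund_field_invariant x gI).
  rewrite (bivector_anti HP fS (smooth_fun_cst M 0)) !(bivector0l HP) //.
  by rewrite !oppr0 !addr0.
- by move=> a f g k [fS _] [gS _] [kS _]; exact: (bivector_linear HP).
- by move=> f g [fS _] [gS _]; exact: (bivector_anti HP).
- by move=> f g k [fS _] [gS _] [kS _]; exact: (bivector_leibniz HP).
(* [half_schouten] is the Jacobiator itself, equal to phi_M, which vanishes on invariant
   functions. *)
- move=> f g k fI gI kI; have := HJ f g k fI.1 gI.1 kI.1.
  by rewrite mult_ext3_invariant.
Qed.
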